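(* Let $p$ be a prime number with $p\equiv 3 \pmod 4$, let $\alpha$ and $k$ be positive integers, and let $c\in\mathbb{Z}_{p^{\alpha}}$. Then $$\mathscr{S}_{sq}(\mathbb{Z}_{p^{\alpha}},c,k)=\begin{cases} p^{(\alpha-1)(k-1)}\,2^k\,(b_{k-1,p}+c_{k-1,p}) & \text{if } c\equiv 0 \pmod p,\\ p^{(\alpha-1)(k-1)}\,2^k\,(a_{k-1,p}+b_{k-1,p}) & \text{if } c=x^2 \text{ for some } x\in\mathbb{Z}_{p^{\alpha}}^{\ast},\\ p^{(\alpha-1)(k-1)}\,2^k\, b_{k-1,p} & \text{otherwise,}\end{cases}$$ where, with $i=\sqrt{-1}\in\mathbb{C}$ and for every integer $n\ge 0$, $$a_{n,p}=\frac{\sqrt{p}+i}{2\sqrt{p}}\Big(\frac{-1+i\sqrt{p}}{2}\Big)^n+\frac{\sqrt{p}-i}{2\sqrt{p}}\Big(\frac{-1-i\sqrt{p}}{2}\Big)^n,$$ $$c_{n,p}=-\frac{p+1}{4}\left(\frac{\sqrt{p}+i}{2\sqrt{p}}\Big(\frac{-1+i\sqrt{p}}{2}\Big)^{n-1}+\frac{\sqrt{p}-i}{2\sqrt{p}}\Big(\frac{-1-i\sqrt{p}}{2}\Big)^{n-1}\right),$$ $$b_{n,p}=\frac{p-1}{2p}\Big(\frac{p-1}{2}\Big)^n+\frac{p+1}{8\sqrt{p}}\left(\frac{(\sqrt{p}+i)(i\sqrt{p}-1)}{i\sqrt{p}-p}\Big(\frac{-1+i\sqrt{p}}{2}\Bi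g)^{n-1}+\frac{(\sqrt{p}-i)(i\sqrt{p}+1)}{i\sqrt{p}+p}\Big(\frac{-1-i\sqrt{p}}{2}\Big)^{n-1}\right).$$
   Context: $\mathbb{Z}_n$ is the ring of residue classes modulo $n$ and $\mathbb{Z}_n^{\ast}$ its group of units. For $c\in\mathbb{Z}_n$ and a positive integer $k$, $\mathscr{S}_{sq}(\mathbb{Z}_n,c,k)$ denotes the number of tuples $(x_1,\ldots,x_k)\in(\mathbb{Z}_n^{\ast})^k$ with $x_1^2+\cdots+x_k^2=c$ in $\mathbb{Z}_n$. *)

(* Defs.v *)
From mathcomp Require Import all_boot all_order all_algebra all_fingroup.
From mathcomp Require Import reals.
From mathcomp Require Import complex.

Set Implicit Arguments.
Unset Strict Implicit.
Unset Printing Implicit Defensive.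

Import GRing.Theory Num.Theory.

Local Open Scope ring_scope.
Local Open Scope complex_scope.

Definition S_sq (A : finComUnitRingType) (c : A) (k : nat) : nat :=
  #|[set x : k.-tuple {unit A} | \sum_(j < k) val (tnth x j) ^+ 2 == c]|.

Section Coefficients.

Variables (R : realType) (p : nat).

Let s : R[i] := (Num.sqrt p%:R)%:C.
Let i : R[i] := 'i%C.

(* The exponent is an integer because [c_coef] and [b_coef] use the power
   [n - 1], which is an inverse when [n = 0]. *)
Definition a_power (m : int) : R[i] :=
  (s + i) / (2 * s) * ((-1 + i * s) / 2) ^ m
  + (s - i) / (2 * s) * ((-1 - i * s) / 2) ^ m.

Definition a_coef (n : nat) : R[i] := a_power n%:Z.

Definition c_coef (n : nat) : R[i] :=
  - ((p%:R + 1) / 4) * a_power (n%:Z - 1).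

Definition b_coef (n : nat) : R[i] :=
  (p%:R - 1) / (2 * p%:R) * ((p%:R - 1) / 2) ^+ n
  + (p%:R + 1) / (8 * s)
    * ((s + i) * (i * s - 1) / (i * s - p%:R)
         * ((-1 + i * s) / 2) ^ (n%:Z - 1)
       + (s - i) * (i * s + 1) / (i * s + p%:R)
         * ((-1 - i * s) / 2) ^ (n%:Z - 1)).

End Coefficients.

(* Main.v *)
(* Let A be a finite local ring, J its maximal ideal and Q its set of unit
   squares, and suppose that a sum of two unit squares is always a unit; for
   Z/p^alpha this is where p = 3 mod 4 enters. Then 2 is a unit, squaring is
   2-to-1 on units, and A is the disjoint union of J, Q and -Q. Hence the number
   of k-tuples of units whose squares sum to c depends only on the class of c,
   and passing from k to k+1 multiplies the three values by a fixed 3 x 3 matrix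
   whose entries are the numbers of v in Q with c - v in a given class. With d
   the number of v in Q such that 1 - v is in Q, the bijections v |-> v^-1 and
   v |-> v + 1 express all these entries through |J| and d, where
   |Q| = |J| + 2d. The closed forms satisfy the same recurrence because
   (-1 +- i sqrt p)/2 are the roots of X^2 + X + (p+1)/4. *)
Require Import Defs.
From mathcomp Require Import all_boot all_order all_algebra all_fingroup.
From mathcomp Require Import finfield reals.
From mathcomp Require Import complex.
From mathcomp Require Import zify ring.

Set Implicit Arguments.
Unset Strict Implicit.
Unset Printing Implicit Defensive.

Import GRing.Theory Num.Theory.
Local Open Scope ring_scope.

(** * Recursion on the number of squares *)

Lemma S_sq0 (A : finComUnitRingType) (c : A) : S_sq c 0 = (c == 0).
Proof.
rewrite /S_sq; case: eqP => c0.
  by apply: (@eq_card1 _ [tuple]) => t; rewrite !inE [t]tuple0 big_ord0 c0 !eqxx.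
by apply: eq_card0 => t; rewrite !inE big_ord0 eq_sym; apply/eqP.
Qed.

Lemma S_sqS (A : finComUnitRingType) (c : A) k :
  S_sq c k.+1 = (\sum_(u : {unit A}) S_sq (c - val u ^+ 2)%R k)%N.
Proof.
rewrite /S_sq -sum1_card.
rewrite (partition_big (fun t : k.+1.-tuple {unit A} => thead t) xpredT) //=.
apply: eq_bigr => u _; rewrite sum1dep_card.
have consI : injective (fun t : k.-tuple {unit A} => [tuple of u :: t]).
  by move=> t1 t2 /(congr1 (behead \o val)) /= /val_inj.
rewrite -(card_imset _ consI).
have headE (t : k.-tuple {unit A}) :
    (\sum_(j < k.+1) val (tnth [tuple of u :: t] j) ^+ 2 == c)
    = (\sum_(j < k) val (tnth t j) ^+ 2 == c - val u ^+ 2).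
  rewrite big_ord_recl tnth0 [RHS]eq_sym subr_eq [LHS]eq_sym addrC.
  by under eq_bigr do rewrite tnthS.
apply: eq_card => t; apply/idP/imsetP => [|[t' + ->]]; rewrite !inE.
  case/tupleP: t => v t; rewrite theadE => /andP[+ /eqP vu].
  by rewrite vu headE => tc; exists t; rewrite ?inE.
by rewrite headE theadE eqxx => ->.
Qed.

(** * Unit squares in a finite local ring *)

Section UnitSquares.

Variable A : finComUnitRingType.

Definition nonunits : {set A} := [set x | x \isn't a GRing.unit].
Definition unit_squares : {set A} := [set val u ^+ 2 | u : {unit A}].

Local Notation J := nonunits.
Local Notation Q := unit_squares.

Lemma card_units_nonunits : (#|{: {unit A}}| + #|J| = #|A|)%N.
Proof.
rewrite -(cardC (mem J)) addnC; congr addn.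
rewrite -(card_image val_inj); apply: eq_card => x.
rewrite !inE negbK; apply/imageP/idP => [[u _ ->]|xU]; first exact: (valP u).
by exists (FinRing.unit A xU).
Qed.

Lemma unit_squaresP x :
  reflect (exists2 y, y \is a GRing.unit & x = y ^+ 2) (x \in Q).
Proof.
apply: (iffP imsetP) => [[u _ ->]|[y yU ->]].
  by exists (val u); rewrite ?(valP u).
by exists (FinRing.unit A yU).
Qed.

Lemma unit_squares1 : 1 \in Q.
Proof. by apply/unit_squaresP; exists 1; rewrite ?unitr1 ?expr1n. Qed.

Lemma unit_squares_unit x : x \in Q -> x \is a GRing.unit.
Proof. by move=> /unit_squaresP[y yU ->]; rewrite unitrX. Qed.

Lemma unit_squaresM x y : x \in Q -> y \in Q -> x * y \in Q.
Proof.
move=> /unit_squaresP[a aU ->] /unit_squaresP[b bU ->].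
by apply/unit_squaresP; exists (a * b); rewrite ?unitrM ?aU // exprMn.
Qed.

Lemma unit_squaresV x : x \in Q -> x^-1 \in Q.
Proof.
move=> /unit_squaresP[a aU ->].
by apply/unit_squaresP; exists a^-1; rewrite ?unitrV // exprVn.
Qed.

(** The first hypothesis makes [A] local. The second, applied to 1 + 1, makes 2 a unit; it also
    keeps -1 out of [Q], as 1 + (-1) = 0 is not a unit. *)
Hypothesis nonunitsD : forall x y, x \in J -> y \in J -> x + y \in J.
Hypothesis unit_squaresD : forall x y, x \in Q -> y \in Q -> x + y \notin J.

Lemma nonunitsN x : (- x \in J) = (x \in J).
Proof. by rewrite !inE unitrN. Qed.

Lemma unit_squares_nonunits x : x \in Q -> x \notin J.
Proof. by rewrite inE negbK; apply: unit_squares_unit. Qed.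

Lemma unit_squaresN x : x \in Q -> - x \notin Q.
Proof.
move=> xQ; apply/negP => /(unit_squaresD xQ); rewrite subrr.
by rewrite inE unitr0.
Qed.

(** In (x - y)(x + y) = 0 a unit factor cancels. If neither factor were a unit, their sum 2x would
    be a nonunit, although 2 and x are units. *)
Lemma sqr_unit_eq (x y : A) : x \is a GRing.unit -> y \is a GRing.unit ->
  (x ^+ 2 == y ^+ 2) = (x == y) || (x == - y).
Proof.
move=> xU yU; apply/idP/orP => [|[] /eqP ->]; rewrite ?sqrrN //.
rewrite -subr_eq0 subr_sqr => /eqP xy0.
have [xyU|xyN] := boolP (x - y \is a GRing.unit).
  right; rewrite -subr_eq0 opprK; apply/eqP/(mulrI xyU).
  by rewrite xy0 mulr0.
have [xyU|xyN'] := boolP (x + y \is a GRing.unit).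
  left; rewrite -subr_eq0; apply/eqP/(mulIr xyU).
  by rewrite xy0 mul0r.
have /nonunitsD : x - y \in J by rewrite inE.
move=> /(_ (x + y)); rewrite inE xyN' => /(_ isT).
have -> : x - y + (x + y) = x * (1 + 1) by ring.
rewrite inE unitrM xU /=.
by have := unit_squaresD unit_squares1 unit_squares1; rewrite inE negbK => ->.
Qed.

Lemma unit_neqN (x : A) : x \is a GRing.unit -> x != - x.
Proof.
move=> xU; rewrite -subr_eq0 opprK; apply/eqP => x2.
have := unit_squaresD unit_squares1 unit_squares1; rewrite inE negbK => U2.
suff : (0 : A) \is a GRing.unit by rewrite unitr0.
by rewrite -x2 -[x]mulr1 -mulrDr unitrM xU.
Qed.

Lemma card_sqr_fiber v : v \in Q -> #|[pred u : {unit A} | val u ^+ 2 == v]| = 2%N.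
Proof.
move=> /imsetP[u _ ->].
have uNU : - val u \is a GRing.unit by rewrite unitrN (valP u).
pose u' := FinRing.unit A uNU.
transitivity #|[set u; u']|; last by rewrite cards2 -val_eqE unit_neqN ?(valP u).
apply: eq_card => w.
by rewrite !inE -!val_eqE [LHS]sqr_unit_eq ?(valP w) ?(valP u).
Qed.

Lemma sum_unit_sqr (V : nmodType) (F : A -> V) :
  \sum_(u : {unit A}) F (val u ^+ 2) = (\sum_(v in Q) F v) *+ 2.
Proof.
rewrite (partition_big (fun u : {unit A} => val u ^+ 2) (mem Q)) /=; last first.
  by move=> u _; apply/imsetP; exists u.
rewrite -sumrMnl; apply: eq_bigr => v vQ.
rewrite (eq_bigr (fun=> F v)); last by move=> w /eqP <-.
by rewrite sumr_const card_sqr_fiber.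
Qed.

Lemma card_unit_squares : (2 * #|Q| + #|J| = #|A|)%N.
Proof.
rewrite -card_units_nonunits; congr addn.
rewrite -[RHS]sum1_card (partition_big (fun u : {unit A} => val u ^+ 2) (mem Q)) /=.
  rewrite mulnC -sum_nat_const; apply: eq_bigr => v vQ.
  by rewrite sum1_card card_sqr_fiber.
by move=> u _; apply/imsetP; exists u.
Qed.

(* By counting: Q and -Q are disjoint and have half as many elements as there are
   units. *)
Lemma unit_squares_total x : [|| x \in J, x \in Q | - x \in Q].
Proof.
have QNQ : Q :&: (-%R @: Q) = set0.
  apply/setP => y; rewrite in_setI in_set0; apply/andP => -[yQ /imsetP[z zQ yz]].
  by move: yQ; rewrite yz; apply/negP/unit_squaresN.
have JQ : J :&: (Q :|: (-%R @: Q)) = set0.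
  apply/setP => y; rewrite in_setI in_setU in_set0.
  apply/andP => -[yJ /orP[yQ|/imsetP[z zQ yz]]].
    by move: yJ; apply/negP/unit_squares_nonunits.
  by move: yJ; rewrite yz nonunitsN; apply/negP/unit_squares_nonunits.
have : J :|: (Q :|: (-%R @: Q)) = [set: A].
  apply/eqP; rewrite eqEcard subsetT /= cardsT -card_unit_squares.
  rewrite !cardsU JQ QNQ !cards0 !subn0 (card_imset _ oppr_inj).
  by rewrite addnC mul2n -addnn.
move=> /setP /(_ x); rewrite !in_setU in_setT.
move=> /or3P[-> //|->|/imsetP[y yQ ->]]; first by rewrite orbT.
by rewrite opprK yQ !orbT.
Qed.

(** The two other classes are impossible: x + y in [J] would force x into [J], and -(x + y) in [Q]
    would make -y = x - (x + y) a sum of two unit squares, hence a unit. *)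
Lemma unit_squaresDJ x y : x \in Q -> y \in J -> x + y \in Q.
Proof.
move=> xQ yJ; case/or3P: (unit_squares_total (x + y)) => // h.
  have := @nonunitsD _ (- y) h; rewrite nonunitsN => /(_ yJ).
  by rewrite addrK => xJ; have := unit_squares_nonunits xQ; rewrite xJ.
have := unit_squaresD xQ h.
by rewrite opprD addNKr nonunitsN yJ.
Qed.

(** * Counting the differences c - v, for v in [Q], in each class *)

Definition sums (c : A) : {set A} := [set v in Q | c - v \in Q].

Lemma card_sums_scale x c : x \in Q -> #|sums (x * c)| = #|sums c|.
Proof.
move=> xQ; have xU := unit_squares_unit xQ.
rewrite -(card_imset (mem (sums c)) (mulrI xU)); apply: eq_card => v.
rewrite [LHS]inE; apply/andP/imsetP => [[vQ cvQ]|[w + ->]].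
  exists (x^-1 * v); last by rewrite mulVKr.
  rewrite inE unit_squaresM ?unit_squaresV //=.
  have -> : c - x^-1 * v = x^-1 * (x * c - v) by rewrite mulrBr mulKr.
  by rewrite unit_squaresM ?unit_squaresV.
by rewrite inE => /andP[wQ cwQ]; rewrite -mulrBr !unit_squaresM.
Qed.

(** Inversion exchanges the two sets, because 1 - w^-1 = (w - 1) w^-1. *)
Lemma card_diffs1 : #|[set v in Q | v - 1 \in Q]| = #|sums 1|.
Proof.
rewrite -(card_imset _ (@invr_inj A)); apply: eq_card => v.
rewrite [RHS]inE; apply/imsetP/andP => [[w + ->]|[vQ cvQ]].
  rewrite inE => /andP[wQ w1Q]; rewrite unit_squaresV //; split=> //.
  have -> : 1 - w^-1 = (w - 1) * w^-1.
    by rewrite mulrBl divrr ?mul1r ?unit_squares_unit.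
  by rewrite unit_squaresM ?unit_squaresV.
exists v^-1; last by rewrite invrK.
rewrite inE unit_squaresV //=.
have -> : v^-1 - 1 = (1 - v) * v^-1.
  by rewrite mulrBl divrr ?mul1r ?unit_squares_unit.
by rewrite unit_squaresM ?unit_squaresV.
Qed.

Lemma class_sum x : ((x \in J) + (x \in Q) + (- x \in Q) = 1)%N.
Proof.
case/or3P: (unit_squares_total x) => h; rewrite h.
- have -> : x \in Q = false by apply: contraTF h => /unit_squares_nonunits.
  have -> // : - x \in Q = false.
  by rewrite -nonunitsN in h; apply: contraTF h => /unit_squares_nonunits.
- by rewrite (negbTE (unit_squares_nonunits h)) (negbTE (unit_squaresN h)).
- rewrite -nonunitsN (negbTE (unit_squares_nonunits h)).
  by move: (unit_squaresN h); rewrite opprK => /negbTE ->.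
Qed.

Lemma card_split (P1 P2 P3 : pred A) (S : {set A}) :
  (forall x, x \in S -> (P1 x + P2 x + P3 x = 1)%N) ->
  (#|[set x in S | P1 x]| + #|[set x in S | P2 x]| + #|[set x in S | P3 x]|
   = #|S|)%N.
Proof.
move=> h; rewrite -!sum1dep_card !big_mkcondr /= -!big_split /= -sum1_card.
by apply: eq_bigr => x /h; case: (P1 x); case: (P2 x); case: (P3 x).
Qed.

Lemma card_diff_classes (c : A) :
  (#|[set v in Q | (c - v)%R \in J]| + #|sums c| + #|[set v in Q | (v - c)%R \in Q]|
   = #|Q|)%N.
Proof.
by apply: card_split => v _; rewrite -(class_sum (c - v)) opprB.
Qed.

Lemma card_diff_unit c : - c \in Q -> #|[set v in Q | (c - v)%R \in J]| = 0%N.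
Proof.
move=> cQ; apply: eq_card0 => v; rewrite [LHS]inE; apply/andP => -[vQ].
by rewrite -nonunitsN opprB; apply/negP/unit_squaresD.
Qed.

(** The map y |-> c - y is a bijection from [J] onto this set: adding a nonunit does not leave
    [Q]. *)
Lemma card_diff_nonunit c : c \in Q -> #|[set v in Q | (c - v)%R \in J]| = #|J|.
Proof.
move=> cQ; have cBI : injective (fun v => c - v) by move=> v w /addrI /oppr_inj.
rewrite -(card_imset (mem J) cBI); apply: eq_card => v.
rewrite [LHS]inE; apply/andP/imsetP => [[vQ cvJ]|[y yJ ->]].
  by exists (c - v); rewrite // opprB addrC subrK.
by rewrite opprB addrCA subrr addr0 unit_squaresDJ ?nonunitsN.
Qed.

Lemma card_unit_squaresE : #|Q| = (#|J| + 2 * #|sums 1%R|)%N.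
Proof.
rewrite -(card_diff_classes 1) card_diff_nonunit ?unit_squares1 // card_diffs1.
by rewrite mul2n -addnn addnA.
Qed.

(** Split [Q] by the class of -1 - v. It is never in [J], and the v with v + 1 in [Q] correspond by
    translation to the set of [card_diffs1]; what is left of |Q| = |J| + 2d is |J| + d. *)
Lemma card_sumsN1 : #|sums (-1)| = (#|J| + #|sums 1%R|)%N.
Proof.
apply/(@addIn #|sums 1|); rewrite -addnA addnn -mul2n -card_unit_squaresE.
rewrite -(card_diff_classes (-1)) card_diff_unit ?opprK ?unit_squares1 // add0n.
congr addn; rewrite -card_diffs1 -[RHS](card_imset _ (addIr (1 : A))).
apply: eq_card => v; rewrite [LHS]inE; apply/andP/imsetP => [[vQ v1Q]|[w + ->]].
  by exists (v - 1); rewrite ?inE subrK ?v1Q.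
by rewrite inE addrK => /andP[].
Qed.

(** * Summing a function that is constant on [J], on [Q] and on -Q *)

Section ClassFunction.

Variables (V : nmodType) (f : A -> V) (z s n : V).
Hypothesis fJ : forall x, x \in J -> f x = z.
Hypothesis fQ : forall x, x \in Q -> f x = s.
Hypothesis fN : forall x, - x \in Q -> f x = n.

Lemma sum_class c :
  \sum_(v in Q) f (c - v) = z *+ #|[set v in Q | (c - v)%R \in J]|
    + s *+ #|sums c| + n *+ #|[set v in Q | (v - c)%R \in Q]|.
Proof.
have cardE (P : pred A) (x : V) :
    x *+ #|[set v in Q | P v]| = \sum_(v in Q) if P v then x else 0.
  by rewrite -sumr_const -big_mkcondr; apply: eq_bigl => v; rewrite inE.
rewrite !cardE -!big_split /=.
apply: eq_bigr => v vQ; have := class_sum (c - v).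
have := @fJ (c - v); have := @fQ (c - v); have := @fN (c - v); rewrite opprB.
case: (c - v \in J); case: (c - v \in Q); case: (v - c \in Q) => //= h1 h2 h3 _.
- by rewrite h3 // !addr0.
- by rewrite h2 // add0r addr0.
- by rewrite h1 // !add0r.
Qed.

Lemma sum_class_nonunit c : c \in J ->
  \sum_(v in Q) f (c - v) = n *+ #|Q|.
Proof.
move=> cJ; rewrite (eq_bigr (fun=> n)) ?sumr_const // => v vQ.
by apply: fN; rewrite opprB unit_squaresDJ ?nonunitsN.
Qed.

Lemma sum_class_square c : c \in Q ->
  \sum_(v in Q) f (c - v) = z *+ #|J| + (s + n) *+ #|sums 1|.
Proof.
move=> cQ; have cE : #|sums c| = #|sums 1| by rewrite -[c in LHS]mulr1 card_sums_scale.
rewrite sum_class card_diff_nonunit // cE mulrnDl addrA; congr (_ + _ *+ _).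
(* The coefficient of [n] is what remains of |Q| = |J| + 2d once |J| and d are removed. *)
have := card_diff_classes c; rewrite card_diff_nonunit // cE card_unit_squaresE.
by rewrite mul2n -addnn addnA => /addnI.
Qed.

Lemma sum_class_nonsquare c : - c \in Q ->
  \sum_(v in Q) f (c - v) = s *+ (#|J| + #|sums 1|) + n *+ #|sums 1|.
Proof.
move=> cQ; have cE : #|sums c| = (#|J| + #|sums 1%R|)%N.
  by rewrite -card_sumsN1 -(card_sums_scale (-1) cQ) mulrN1 opprK.
rewrite sum_class card_diff_unit // cE mulr0n add0r; congr (_ + _ *+ _).
have := card_diff_classes c; rewrite card_diff_unit // cE card_unit_squaresE add0n.
by rewrite mul2n -addnn addnA => /addnI.
Qed.

End ClassFunction.

Lemma S_sqS_class (K : pzSemiRingType) (c : A) k :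
  (S_sq c k.+1)%:R = (\sum_(v in Q) (S_sq (c - v) k)%:R) *+ 2 :> K.
Proof.
rewrite S_sqS natr_sum.
exact: (sum_unit_sqr (fun v => (S_sq (c - v) k)%:R : K)).
Qed.

Lemma S_sq1 (K : pzSemiRingType) c : (S_sq c 1)%:R = (c \in Q)%:R *+ 2 :> K.
Proof.
rewrite S_sqS_class; congr (_ *+ _).
rewrite (eq_bigr (fun v => if v == c then 1 else 0)); last first.
  by move=> v _; rewrite S_sq0 subr_eq0 eq_sym; case: eqP.
rewrite -big_mkcondr.
have [cQ|cQ] := boolP (c \in Q).
  by rewrite (big_pred1 c) // => v; rewrite andbC /=; case: eqP => [->|_].
by apply: big1 => v /andP[vQ /eqP vc]; rewrite -vc vQ in cQ.
Qed.

(** Up to the factor [M], [b] is the count on -Q, [a] and [e] are the excesses over it on [Q] and on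
    [J], and [t] stands for d / |J|. As |Q| = (2t + 1)|J|, one more square contributes 2|J| to [M],
    and the three class sums turn into the assumed recurrences. *)
Lemma S_sq_recurrence (K : comNzRingType) (t : K) (a b e : nat -> K) :
  t * #|J|%:R = #|sums 1|%:R ->
  a 0 = 1 -> b 0 = 0 -> e 0 = 0 ->
  (forall n, a n.+1 = e n - a n) ->
  (forall n, b n.+1 = (2 * t + 1) * b n + (t + 1) * a n) ->
  (forall n, e n.+1 = - (t + 1) * a n) ->
  forall n (c : A), let M := #|J|%:R ^+ n * 2 ^+ n.+1 in
  [/\ c \in J -> (S_sq c n.+1)%:R = M * (b n + e n),
      c \in Q -> (S_sq c n.+1)%:R = M * (a n + b n)
    & - c \in Q -> (S_sq c n.+1)%:R = M * b n].
Proof.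
move=> tJ a0 b0 e0 aS bS eS; elim=> [|n IHn] c M.
  (* The index n belongs to n + 1 squares, so the base case is a single square: the count is 2 on
     [Q] and 0 elsewhere. *)
  rewrite /M a0 b0 e0 S_sq1; have cl := class_sum c.
  by split=> cP; move: cl; rewrite cP; case: (c \in J); case: (c \in Q) => //= _;
     ring.
have fJ x (xJ : x \in J) := let: And3 h _ _ := IHn x in h xJ.
have fQ x (xQ : x \in Q) := let: And3 _ h _ := IHn x in h xQ.
have fN x (xN : - x \in Q) := let: And3 _ _ h := IHn x in h xN.
rewrite /= in fJ fQ fN.
rewrite aS bS eS S_sqS_class.
split=> cP.
- rewrite (sum_class_nonunit fN cP) card_unit_squaresE -[_ *+ (_ + _)]mulr_natr.
  by rewrite natrD natrM -tJ /M !exprS; ring.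
- rewrite (sum_class_square fJ fQ fN cP) -[_ *+ #|J|]mulr_natr.
  by rewrite -[_ *+ #|sums 1|]mulr_natr -tJ /M !exprS; ring.
- rewrite (sum_class_nonsquare fJ fQ fN cP) -[_ * b n *+ _]mulr_natr.
  by rewrite -[_ *+ (_ + _)]mulr_natr natrD -tJ /M !exprS; ring.
Qed.

End UnitSquares.

(* If x^2 = - y^2 in F_p, then x = x^p = - x y^(p-1) since (p-1)/2 is odd, so
   that x y = - x y. *)
Lemma prime_dvd_sum_two_squares p (u w : nat) : prime p -> (p = 3 %[mod 4])%N ->
  (p %| u ^ 2 + w ^ 2)%N -> (p %| u)%N || (p %| w)%N.
Proof.
move=> p_pr p3.
have chp := pchar_Fp p_pr.
rewrite !(dvdn_pcharf chp) natrD !natrX.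
move: (u%:R) (w%:R) => x y; rewrite addr_eq0 => /eqP xy.
(* With m = p %/ 4, this form of p displays x^p as x (x^2)^(2m + 1), whose outer exponent is odd. *)
have p_eq : ((p %/ 4).*2.*2.+3 = p)%N by rewrite [RHS](divn_eq p 4) p3; lia.
have xp m : x ^+ m.*2.*2.+3 = - (x * y ^+ m.*2.*2.+2).
  rewrite exprS -doubleS -mul2n !exprM xy exprNn -signr_odd /=.
  by rewrite odd_double mulN1r mulrN.
have {}xp := xp (p %/ 4)%N; rewrite p_eq in xp.
have ex (z : 'F_p) : z ^+ p = z by rewrite -[in X in _ ^+ X](card_Fp p_pr) expf_card.
have : x * y *+ 2 = 0.
  rewrite mulr2n -{1}(ex x) xp mulNr -mulrA -exprSr p_eq ex.
  by rewrite addNr.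
rewrite -mulr_natr => /eqP; rewrite !mulf_eq0 -(dvdn_pcharf chp).
by case: (boolP (p %| 2)%N) => [/dvdn_leq|_]; [lia | rewrite orbF].
Qed.

(** * Initial values and recurrences of the closed forms *)

Section Coefficients.

Variables (R : realType) (p : nat).
Hypothesis p_gt0 : (0 < p)%N.

Let s : R[i] := (Num.sqrt p%:R)%:C%C.
Let i : R[i] := 'i%C.
Let w : R[i] := (-1 + i * s) / 2.
Let w' : R[i] := (-1 - i * s) / 2.

Lemma sqr_complex_sqrt : s ^+ 2 = p%:R.
Proof. by rewrite /s -rmorphXn /= sqr_sqrtr ?ler0n // rmorph_nat. Qed.

Lemma sqrt_neq0 : s != 0.
Proof. by rewrite -sqrf_eq0 sqr_complex_sqrt pnatr_eq0 -lt0n. Qed.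

(** This is the constant term of X^2 + X + (p + 1)/4. It shows that the roots are nonzero, so that
    their integer powers n - 1 can be split. *)
Lemma root_mul : w * w' = (p%:R + 1) / 4.
Proof.
have i2 : i ^+ 2 = -1 := sqr_i R.
by rewrite -sqr_complex_sqrt /w /w'; field: i2.
Qed.

Lemma root_neq0 : (w != 0) * (w' != 0).
Proof.
have : w * w' != 0.
  by rewrite root_mul mulf_neq0 ?invr_eq0 ?natr1 ?pnatr_eq0.
by rewrite mulf_eq0 negb_or => /andP[].
Qed.

Lemma root_numer_neq0 : (-1 + i * s != 0) * (-1 - i * s != 0).
Proof.
have [] := (root_neq0.1, root_neq0.2).
by rewrite !mulf_eq0 !negb_or => /andP[-> _] /andP[-> _].
Qed.

Lemma sqrt_addi_neq0 : (s + i != 0) * (s - i != 0).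
Proof.
have : (s + i) * (s - i) != 0.
  have i2 : i ^+ 2 = -1 := sqr_i R.
  have -> : (s + i) * (s - i) = p%:R + 1 by rewrite -sqr_complex_sqrt; ring: i2.
  by rewrite natr1 pnatr_eq0.
by rewrite mulf_eq0 negb_or => /andP[].
Qed.

(* As (i s - 1) / 2 = w and i s - p = - s (s - i), the inverse powers of w and w'
   in b cancel. *)
Lemma b_coefE n : b_coef R p n =
  (p%:R - 1) / (2 * p%:R) * ((p%:R - 1) / 2) ^+ n
  - (4 * p%:R)^-1 * ((s + i) ^+ 2 * w ^+ n + (s - i) ^+ 2 * w' ^+ n).
Proof.
have i2 : i ^+ 2 = -1 := sqr_i R.
rewrite /b_coef -/s -/i -/w -/w' !expfzDr ?root_neq0 // -!exprnP.
congr (_ + _); rewrite !exprN1 -sqr_complex_sqrt.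
have s0 := sqrt_neq0.
move: (w ^+ n) (w' ^+ n) => x x'; rewrite /w /w'.
have [w2 w'2] := (root_numer_neq0.1, root_numer_neq0.2).
(* With p written as [s ^+ 2], the denominators in [b_coef] factor as s (i + s) and s (i - s). *)
have sD : i * s + s ^+ 2 != 0.
  by rewrite expr2 -mulrDl mulf_neq0 // addrC sqrt_addi_neq0.
have sB : i * s - s ^+ 2 != 0.
  by rewrite expr2 -mulrBl mulf_neq0 // -opprB oppr_eq0 sqrt_addi_neq0.
by field: i2; rewrite s0 w2 w'2 sD sB.
Qed.

Lemma a_coef0 : a_coef R p 0 = 1.
Proof.
by rewrite /a_coef /a_power -/s -/i !expr0z; field; rewrite sqrt_neq0.
Qed.

Lemma c_coefS n : c_coef R p n.+1 = - ((p%:R + 1) / 4) * a_coef R p n.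
Proof. by rewrite /c_coef intS [1 + _]addrC addrK. Qed.

(** Since (p + 1)/4 = w w', the factor w^(n-1) in [c_coef] becomes -w' w^n, and -w' = w + 1 because
    w + w' = -1; likewise with the roots exchanged. *)
Lemma a_coefS n : a_coef R p n.+1 = c_coef R p n - a_coef R p n.
Proof.
have i2 : i ^+ 2 = -1 := sqr_i R.
rewrite /a_coef /c_coef /a_power -/s -/i -/w -/w' !expfzDr ?root_neq0 // -root_mul.
rewrite -!exprnP !exprN1 !exprS; move: (w ^+ n) (w' ^+ n) => x x'.
rewrite /w /w'.
have [w2 w'2] := (root_numer_neq0.1, root_numer_neq0.2).
by field: i2; rewrite sqrt_neq0 w2 w'2.
Qed.

Lemma b_coef0 : b_coef R p 0 = 0.
Proof.
have i2 : i ^+ 2 = -1 := sqr_i R.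
rewrite b_coefE !expr0 -sqr_complex_sqrt.
by field: i2; rewrite sqrt_neq0.
Qed.

(** The exponent is -1 here, and multiplying by w w' leaves (s + i) w' + (s - i) w up to a factor.
    This vanishes because w = i (s + i)/2 and w' = -i (s - i)/2. *)
Lemma c_coef0 : c_coef R p 0 = 0.
Proof.
have i2 : i ^+ 2 = -1 := sqr_i R.
rewrite /c_coef /a_power -/s -/i -/w -/w' sub0r !exprN1 -root_mul.
rewrite /w /w'.
have [w2 w'2] := (root_numer_neq0.1, root_numer_neq0.2).
by field: i2; rewrite sqrt_neq0 w2 w'2.
Qed.

(** The powers of (p - 1)/2 cancel. For the powers of w, use w - (p - 1)/2 = -s (s - i)/2 and (s +
    i)(s - i) = p + 1; the conjugate identities serve for w'. *)
Lemma b_coefS n : b_coef R p n.+1 =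
  (p%:R - 1) / 2 * b_coef R p n + (p%:R + 1) / 4 * a_coef R p n.
Proof.
have i2 : i ^+ 2 = -1 := sqr_i R.
rewrite !b_coefE /a_coef /a_power -/s -/i -/w -/w' -!exprnP !exprS.
rewrite -sqr_complex_sqrt.
move: (w ^+ n) (w' ^+ n) (((s ^+ 2 - 1) / 2) ^+ n) => x x' y.
by rewrite /w /w'; field: i2; rewrite sqrt_neq0.
Qed.

End Coefficients.

(** * The hypotheses and cardinals for residues modulo a prime power *)

Section ZmodPrimePower.

Variables p alpha : nat.
Hypotheses (p_pr : prime p) (alpha_gt0 : (0 < alpha)%N).

Local Notation A := 'Z_(p ^ alpha).

(** ['Z_n] is the ring of residues modulo n only for n > 1, so this bound is needed to compute in
    it. *)
Lemma prime_power_gt1 : (1 < p ^ alpha)%N.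
Proof. by rewrite -{1}(exp1n alpha) ltn_exp2r ?prime_gt1. Qed.

Lemma natr_nonunit (m : nat) : ((m%:R : A) \isn't a GRing.unit) = (p %| m)%N.
Proof.
by rewrite unitZpE ?prime_power_gt1 // coprime_pexpl // prime_coprime // negbK.
Qed.

Lemma Zp_nonunit (x : A) : (x \isn't a GRing.unit) = (p %| x)%N.
Proof. by rewrite -{1}(natr_Zp x) natr_nonunit. Qed.

Lemma card_Zp_units : #|{: {unit A}}| = (p.-1 * p ^ alpha.-1)%N.
Proof.
by rewrite -cardsT card_units_Zp ?totient_pfactor // expn_gt0 prime_gt0.
Qed.

Lemma Zp_nonunitsD (x y : A) :
  x \in nonunits A -> y \in nonunits A -> x + y \in nonunits A.
Proof.
rewrite 2!inE !Zp_nonunit => px py.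
by rewrite inE -(natr_Zp x) -(natr_Zp y) -natrD natr_nonunit dvdn_add.
Qed.

Lemma Zp_unit_squaresD (x y : A) : (p = 3 %[mod 4])%N ->
  x \in unit_squares A -> y \in unit_squares A -> x + y \notin nonunits A.
Proof.
move=> p3 /unit_squaresP[a aU ->] /unit_squaresP[b bU ->].
rewrite inE -(natr_Zp a) -(natr_Zp b) -!natrX -natrD natr_nonunit.
apply/negP => /(prime_dvd_sum_two_squares p_pr p3).
by rewrite -!Zp_nonunit aU bU.
Qed.

Lemma card_Zp_nonunits : #|nonunits A| = (p ^ (alpha - 1))%N.
Proof.
have := card_units_nonunits A; rewrite card_Zp_units card_ord.
rewrite Zp_cast ?prime_power_gt1 // subn1 -[in RHS](prednK alpha_gt0) expnS.
by rewrite -[X in _ = (X * _)%N](prednK (prime_gt0 p_pr)) mulSn addnC => /addIn.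
Qed.

(** Combine 2|Q| + |J| = p |J| with |Q| = |J| + 2d. The result, 4d = (p - 3)|J|, is stated without
    subtraction. *)
Lemma card_Zp_sums1 : (p = 3 %[mod 4])%N ->
  (4 * #|sums (1%R : A)| + 3 * #|nonunits A| = p * #|nonunits A|)%N.
Proof.
move=> p3; have QD x y := @Zp_unit_squaresD x y p3.
have := card_unit_squares Zp_nonunitsD QD.
rewrite (card_unit_squaresE Zp_nonunitsD QD) card_ord Zp_cast ?prime_power_gt1 //.
have qE : (p ^ alpha = p * p ^ (alpha - 1))%N by rewrite -expnS subn1 prednK.
rewrite card_Zp_nonunits [X in _ = X -> _]qE => <-.
by rewrite mulnDr mulnA [RHS]addnAC -mulSnr addnC.
Qed.

End ZmodPrimePower.

Theorem theorem5p6 (R : realType) (p alpha k : nat)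
  (p_prime : prime p) (p_mod4 : (p = 3 %[mod 4])%N)
  (alpha_gt0 : (0 < alpha)%N) (k_gt0 : (0 < k)%N)
  (c : 'Z_(p ^ alpha)) :
  let M : R[i] := p%:R ^+ ((alpha - 1) * (k - 1)) * 2 ^+ k in
  let N : R[i] := (S_sq c k)%:R in
  let c_zero_mod_p := (c = 0 %[mod p])%N in
  let c_unit_square := exists x : {unit 'Z_(p ^ alpha)}, c = val x ^+ 2 in
  [/\ c_zero_mod_p -> N = M * (b_coef R p (k - 1) + c_coef R p (k - 1)),
      c_unit_square -> N = M * (a_coef R p (k - 1) + b_coef R p (k - 1))
    & ~ c_zero_mod_p -> ~ c_unit_square -> N = M * b_coef R p (k - 1)].
Proof.
case: k k_gt0 => // k _ M N zero_c square_c.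
set A := 'Z_(p ^ alpha).
have p_gt0 := prime_gt0 p_prime.
have JD x y := @Zp_nonunitsD _ _ p_prime alpha_gt0 x y.
have QD x y := @Zp_unit_squaresD _ _ p_prime alpha_gt0 x y p_mod4.
have zeroP : zero_c <-> c \in nonunits A.
  rewrite /zero_c inE Zp_nonunit // mod0n; split=> [c0|/eqP //].
  exact/eqP.
have squareP : square_c <-> c \in unit_squares A.
  by split=> [[x cx]|/imsetP[x _ cx]]; [apply/imsetP; exists x | exists x].
(* This is d / |J|, so that 2t + 1 = (p - 1)/2 and t + 1 = (p + 1)/4 are the coefficients in the
   recurrences of [b_coef] and [c_coef]. *)
pose t : R[i] := (p%:R - 3) / 4.
have tJ : t * #|nonunits A|%:R = #|sums (1 : A)|%:R.
  have := congr1 (GRing.natmul (1 : R[i])) (card_Zp_sums1 p_prime alpha_gt0 p_mod4).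
  by rewrite natrD !natrM -/A => h; rewrite /t mulrAC mulrBl -h; field.
have [] := S_sq_recurrence JD QD tJ (a_coef0 R p_gt0) (b_coef0 R p_gt0)
  (c_coef0 R p_gt0) (a_coefS R p_gt0) _ _ k c.
- by move=> n; rewrite b_coefS // /t; field.
- by move=> n; rewrite c_coefS // /t; field.
rewrite card_Zp_nonunits // natrX -exprM.
rewrite /N /M [(k.+1 - 1)%N]subn1 /= => eqJ eqQ eqN.
split=> [/zeroP/eqJ|/squareP/eqQ|nz ns] //.
(* A residue that is neither divisible by p nor a unit square has its opposite in [Q]. *)
apply: eqN; case/or3P: (unit_squares_total JD QD c) => // h.
  by case: nz; apply/zeroP.
by case: ns; apply/squareP.
Qed.
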